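(* Let $(e^{tA})_{t\ge0}$ be a positive and self-adjoint $C_0$-semigroup with generator $A$ on a non-zero ordered Hilbert space $(H,H^+)$, and assume that $H^+\subseteq(H')^+$. Let $u,v\in H^+$ and assume that there exists a quasi-interior point $w\in H^+$ such that $u,v\ge w$. Then $$ -\infty<s(A)=\omega(A)=\lim_{t\to\infty}\frac{\log(v\,|\,e^{tA}u)}{t}. $$
   Context: An ordered Hilbert space $(H,H^+)$ is a real Hilbert space $H$ with inner product $(\cdot|\cdot)$ together with a closed convex cone $H^+$ (so $H^++H^+\subseteq H^+$ and $[0,\infty)H^+\subseteq H^+$) with $H^+\cap(-H^+)=\{0\}$; $x\le y$ means $y-x\in H^+$. Identifying $H$ with its dual via the Riesz–Fréchet theorem, $(H')^+=\{x\in H:(x|y)\ge0\text{ for all }y\in H^+\}$. A vector $w\in H^+$ is a quasi-interior point of $H^+$ if $\bigcup_{n\in\mathbb{N}}[-nw,nw]$ is dense in $H$, where $[a,b]=\{y:a\le y\le b\}$. A $C_0$-semigroup is positive if $e^{tA}H^+\subseteq H^+$ for all $t\ge0$, and self-adjoint if each $e^{tA}$ is self-adjoint. The spectral bound is $s(A):=\sup\{\operatorname{Re}\lambda:\lambda\in\sigma(A)\}$, with the spectrum taken in a complexification of $H$. The growth bound is $\omega(A):=\inf\{\omega\in\mathbb{R}:\exists M\ge1\ \forall t\ge0\ \|e^{tA}\|\le Me^{t\omega}\}$. *)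

(* Defs.v *)
From HB Require Import structures.
From mathcomp Require Import all_boot all_order all_algebra.
From mathcomp Require Import complex.
From mathcomp Require Import all_classical all_reals all_analysis.

Set Implicit Arguments.
Unset Strict Implicit.
Unset Printing Implicit Defensive.

Import Order.TTheory GRing.Theory Num.Theory.
Import numFieldNormedType.Exports.

Local Open Scope classical_set_scope.
Local Open Scope ring_scope.

(* The pair [(x, y)] stands for [x + i y]. *)
Definition complexification (R : rcfType) (V : lmodType R) : Type :=
  (V * V)%type.

Section ComplexScaling.
Variables (R : rcfType) (V : lmodType R).

HB.instance Definition _ :=
  GRing.Zmodule.copy (complexification V) (V * V)%type.

Definition cscale (l : R[i]) (z : complexification V) : complexification V :=
  (complex.Re l *: z.1 - complex.Im l *: z.2,
   complex.Im l *: z.1 + complex.Re l *: z.2).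

Fact cscaleA a b z : cscale a (cscale b z) = cscale (a * b) z.
Proof.
case: a b z => [a1 a2] [b1 b2] [x y]; rewrite /cscale /=; congr (_, _).
  by rewrite !scalerBl !scalerBr !scalerDl !scalerDr !scalerA !opprD addrACA.
rewrite !scalerBl !scalerBr !scalerDl !scalerDr !scalerA addrACA.
by congr (_ + _); rewrite addrC.
Qed.

Fact cscale1 : left_id 1 cscale.
Proof. by case=> x y; rewrite /cscale /= !scale1r !scale0r subr0 add0r. Qed.

Fact cscaleDr : right_distributive cscale +%R.
Proof.
move=> [a b] [x1 y1] [x2 y2]; rewrite /cscale /=; congr (_, _) => /=.
  by rewrite !scalerDr opprD addrACA.
by rewrite !scalerDr addrACA.
Qed.

Fact cscaleDl z : {morph cscale^~ z : a b / a + b}.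
Proof.
case: z => x y [a1 a2] [b1 b2]; rewrite /cscale /=; congr (_, _) => /=.
  by rewrite !scalerDl opprD addrACA.
by rewrite !scalerDl addrACA.
Qed.

HB.instance Definition _ := GRing.Zmodule_isLmodule.Build R[i]
  (complexification V) cscaleA cscale1 cscaleDr cscaleDl.

End ComplexScaling.

Section Operators.
Variable R : realType.

(* Possibly unbounded operators: [op_fun A] is only meaningful on [op_dom A]. *)
Record operator (E : Type) := Operator { op_dom : set E; op_fun : E -> E }.

Definition complexify (V : lmodType R) (A : operator V) :
    operator (complexification V) :=
  Operator [set z | op_dom A z.1 /\ op_dom A z.2]
           (fun z => (op_fun A z.1, op_fun A z.2)).

Definition cnorm (V : normedModType R) (z : complexification V) : R :=
  Num.sqrt (`|z.1| ^+ 2 + `|z.2| ^+ 2).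

Definition resolvent_set (V : normedModType R)
    (A : operator (complexification V)) : set R[i] :=
  [set l | exists S : {linear complexification V -> complexification V},
    [/\ exists M : R, forall z, cnorm (S z) <= M * cnorm z,
        forall z, op_dom A (S z) /\ l *: S z - op_fun A (S z) = z &
        forall z, op_dom A z -> S (l *: z - op_fun A z) = z]].

Definition spectrum (V : normedModType R) (A : operator V) : set R[i] :=
  ~` resolvent_set (complexify A).

Definition spectral_bound (V : normedModType R) (A : operator V) : \bar R :=
  ereal_sup [set (complex.Re l)%:E | l in spectrum A].

Definition op_norm (V : normedModType R) (f : V -> V) : \bar R :=
  ereal_sup [set `|f x|%:E | x in [set x | `|x| <= 1]].

(* Semigroups are indexed by [R], but only the values at [t >= 0] matter. *)
Record C0_semigroup (V : normedModType R) (T : R -> {linear V -> V}) : Prop := {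
  C0_bounded : forall t, 0 <= t -> continuous (T t) ;
  C0_id : forall x, T 0 x = x ;
  C0_add : forall s t, 0 <= s -> 0 <= t -> forall x, T (s + t) x = T s (T t x) ;
  C0_strong : forall x, T t x @[t --> 0^'+] --> x }.

Definition generator (V : normedModType R) (T : R -> {linear V -> V}) :
    operator V :=
  Operator [set x | cvg (h^-1 *: (T h x - x) @[h --> 0^'+])]
           (fun x => lim (h^-1 *: (T h x - x) @[h --> 0^'+])).

Definition growth_bound (V : normedModType R) (T : R -> {linear V -> V}) :
    \bar R :=
  ereal_inf [set a%:E | a in [set a : R | exists2 M : R, 1 <= M &
    forall t, 0 <= t -> (op_norm (T t) <= (M * expR (t * a))%:E)%E]].

(* Together with completeness of the norm, this makes [H] a Hilbert space. *)
Definition inner_product_for (H : normedModType R)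
    (ip : {dot H for idfun}) : Prop :=
  forall x, ip x x = `|x| ^+ 2.

Record closed_cone (H : normedModType R) (C : set H) : Prop := {
  cone_closed : closed C ;
  cone_nonempty : C !=set0 ;
  cone_add : forall x y, C x -> C y -> C (x + y) ;
  cone_scale : forall (a : R) x, 0 <= a -> C x -> C (a *: x) ;
  cone_pointed : forall x, C x -> C (- x) -> x = 0 }.

Definition cone_le (H : normedModType R) (C : set H) (x y : H) : Prop :=
  C (y - x).

Definition order_interval (H : normedModType R) (C : set H) (a b : H) : set H :=
  [set y | cone_le C a y /\ cone_le C y b].

Definition quasi_interior (H : normedModType R) (C : set H) (w : H) : Prop :=
  C w /\ dense (\bigcup_n order_interval C (- (w *+ n)) (w *+ n)).

(* The dual cone, as a subset of [H] through the Riesz-Frechet theorem. *)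
Definition dual_cone (H : normedModType R) (ip : {dot H for idfun})
    (C : set H) : set H :=
  [set x | forall y, C y -> 0 <= ip x y].

Definition positive_semigroup (H : normedModType R) (C : set H)
    (T : R -> {linear H -> H}) : Prop :=
  forall t, 0 <= t -> forall x, C x -> C (T t x).

Definition selfadjoint_semigroup (H : normedModType R)
    (ip : {dot H for idfun}) (T : R -> {linear H -> H}) : Prop :=
  forall t, 0 <= t -> forall x y, ip (T t x) y = ip x (T t y).

End Operators.

(* Main.v *)
Require Import Defs.
From HB Require Import structures.
From mathcomp Require Import all_boot all_order all_algebra.
From mathcomp Require Import complex.
From mathcomp Require Import all_classical all_reals all_analysis.
From mathcomp Require Import ring lra.
Set Implicit Arguments.
Unset Strict Implicit.
Unset Printing Implicit Defensive.
Import Order.TTheory GRing.Theory Num.Theory.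
Import numFieldNormedType.Exports.
Local Open Scope classical_set_scope.
Local Open Scope ring_scope.

(** Let A be the generator, and let w be the logarithm of the operator norm of
    [T 1]. Both bounds and the limit are shown to be equal to w.

    Log-convexity. Self-adjointness gives
    |T (t + h) x|^2 = (T t x | T (t + 2h) x), so by Cauchy-Schwarz every orbit
    norm t |-> |T t x| is log-convex ([orbit_logconvex]). Along an arithmetic
    progression of times its successive ratios increase, so the first ratio is
    at most, and the last ratio at least, the geometric mean of all of them.
    Strong continuity at 0 then shows that an orbit starting at x != 0 never
    vanishes ([semigroup_neq0]), so w is finite, and comparison with the first
    ratio turns the single inequality |T 1 x| <= e^w |x| into
    |T t x| <= e^(w t) |x| for all t ([norm_semigroup_le]). Hence w is the
    growth bound ([growth_boundE]).

    The half plane Re l > w lies in the resolvent set. For real a > w the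
    semigroup U t = e^(- a t) T t has |U 1| < 1, so 1 - U 1 is invertible by
    coercivity. If g = (1 - U 1)^-1 y, the integral of U s g over [0, 1] solves
    (a - A) x = y; it is obtained as the limit of Riemann sums, whose telescoping
    identities replace integration theory ([riemann_lim_orbit],
    [resolvent_onto]). The inequality (A x | x) <= w |x|^2 on the domain makes
    the solution unique, which yields a bounded symmetric resolvent Q at a
    ([real_resolvent]). For l = a + i b the resolvent is
    (1 + b^2 Q^2)^-1 (Q - i b Q^2), where 1 + b^2 Q^2 is again coercive
    ([half_plane_resolvent]).

    The point w lies in the spectrum. If w - A had an inverse bounded by M, then
    positivity of the form ((w - A) x | y) would force
    (A x | x) <= (w - 1/M) |x|^2 on the domain
    ([coercive_of_bounded_inverse]). By log-convexity, now used through the last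
    ratio, such an estimate makes |T 1| strictly smaller than e^w
    ([decay_of_numerical_bound]), which is absurd. So w is the spectral bound
    ([spectral_boundE]).

    The limit. The upper estimate is Cauchy-Schwarz. For the lower one let q be
    the quasi-interior point below u and v. Positivity gives
    (v | T t u) >= (q | T t q), and n^2 (q | T t q) >= (x | T t x) for all x in
    the order interval [- n q, n q]. These x are dense, so for every b < w one of
    them satisfies |T 1 x| > e^b |x|, and by log-convexity (x | T t x) grows at
    least like e^(b t) ([quasi_interior_entry_ge]). *)

(** Operators are often obtained pointwise by choice; this packs such a
    function, once known to be linear, as a linear map. *)
Lemma linear_witness (K : pzRingType) (U V : lmodType K) (f : U -> V) :
  linear f -> exists g : {linear U -> V}, g =1 f.
Proof.
move=> lf.
pose g : {linear U -> V} := HB.pack f (GRing.isLinear.Build K U V *:%R f lf).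
by exists g.
Qed.

(** * Inner products *)

Section InnerProduct.
Context {R : realType} {H : completeNormedModType R} {ip : {dot H for idfun}}.
Hypothesis ipE : inner_product_for ip.

Lemma ipC x y : ip x y = ip y x.
Proof. by rewrite hermC expr0 mul1r. Qed.

Lemma ipDl x y z : ip (x + y) z = ip x z + ip y z.
Proof. by rewrite linearDl. Qed.

Lemma ipDr x y z : ip x (y + z) = ip x y + ip x z.
Proof. by rewrite linearD. Qed.

Lemma ipZl a x y : ip (a *: x) y = a * ip x y.
Proof. by rewrite linearZl_LR. Qed.

Lemma ipZr a x y : ip x (a *: y) = a * ip x y.
Proof. by rewrite ipC ipZl ipC. Qed.

Lemma ipNl x y : ip (- x) y = - ip x y.
Proof. by rewrite linearNl. Qed.

Lemma ipNr x y : ip x (- y) = - ip x y.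
Proof. by rewrite ipC ipNl ipC. Qed.

Definition ip_lin := (ipDl, ipDr, ipZl, ipZr, ipNl, ipNr).

Lemma normB_sqr x y : `|x - y| ^+ 2 = `|x| ^+ 2 - 2 * ip x y + `|y| ^+ 2.
Proof. by rewrite -!ipE !ip_lin (ipC y x); ring. Qed.

(** The square of the norm of [|y| x - |x| y] is nonnegative. *)
Lemma cauchy_schwarz x y : ip x y <= `|x| * `|y|.
Proof.
have [->|x0] := eqVneq x 0; first by rewrite linear0l normr0 mul0r.
have [->|y0] := eqVneq y 0; first by rewrite linear0 normr0 mulr0.
have nx : 0 < `|x| by rewrite normr_gt0.
have ny : 0 < `|y| by rewrite normr_gt0.
have := sqr_ge0 `|(`|y| *: x - `|x| *: y)|.
rewrite normB_sqr !normrZ !ip_lin !normr_id => h.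
have : 0 <= (2 * (`|x| * `|y|)) * (`|x| * `|y| - ip x y) by lra.
by rewrite pmulr_rge0 ?subr_ge0// mulr_gt0// mulr_gt0.
Qed.

Lemma cauchy_schwarz_abs x y : `|ip x y| <= `|x| * `|y|.
Proof.
rewrite ler_norml cauchy_schwarz andbT lerNl -ipNl.
by rewrite (le_trans (cauchy_schwarz _ _))// normrN.
Qed.

(** Identities between vectors are reduced by this lemma to identities between
    numbers, which are within reach of [ring]. *)
Lemma ip_ext x y : (forall z, ip x z = ip y z) -> x = y.
Proof.
move=> xy; apply/eqP; rewrite -subr_eq0 -normr_eq0 -sqrf_eq0 -ipE.
by rewrite ipDl ipNl xy subrr.
Qed.

End InnerProduct.

(** * Inverses of coercive operators *)

Section Coercive.
Context {R : realType} {H : completeNormedModType R} {ip : {dot H for idfun}}.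
Hypothesis ipE : inner_product_for ip.
Variables (B : {linear H -> H}) (K c : R).
Hypotheses (c_gt0 : 0 < c) (B_bounded : forall x, `|B x| <= K * `|x|).
Hypothesis B_coercive : forall x, c * `|x| ^+ 2 <= ip (B x) x.

Lemma coercive_lower_bound x : c * `|x| <= `|B x|.
Proof.
have [->|x0] := eqVneq x 0; first by rewrite linear0 normr0 mulr0.
have nx : 0 < `|x| by rewrite normr_gt0.
rewrite -(ler_pM2r nx); apply: le_trans (cauchy_schwarz ipE _ _).
by rewrite -mulrA -expr2.
Qed.

(** Solving B x = y means finding a fixed point of x |-> x - tau (B x - y).
    Since |d - tau B d|^2 <= (1 - 2 tau c + tau^2 L^2) |d|^2, this map is a
    strict contraction for the choice tau = c / L^2, where L bounds B. *)
Lemma coercive_onto y : exists x, B x = y.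
Proof.
(* K need not be positive, and tau needs a positive bound. *)
pose L := Num.max K c.
have L0 : 0 < L by rewrite /L lt_max c_gt0 orbT.
have cL : c <= L by rewrite /L le_max lexx orbT.
have BL x : `|B x| <= L * `|x|.
  by apply: (le_trans (B_bounded x)); rewrite ler_wpM2r// /L le_max lexx.
pose tau := c / L ^+ 2.
have tau0 : 0 < tau by rewrite divr_gt0 ?exprn_gt0.
pose phi x := x - tau *: (B x - y).
pose q := Num.sqrt (1 - tau * c).
have tauc : tau * c <= 1.
  rewrite /tau mulrAC -expr2 ler_pdivrMr ?exprn_gt0// mul1r.
  by rewrite ler_sqr // nnegrE ltW.
have q1 : q < 1.
  by rewrite -[ltRHS]sqrtr1 ltr_sqrt// ltrBlDr ltrDl mulr_gt0.
have contr x z : `|phi x - phi z| <= q * `|x - z|.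
  have -> : phi x - phi z = (x - z) - tau *: B (x - z).
    have phiE w : phi w = (w - tau *: B w) + tau *: y.
      by rewrite /phi scalerBr opprB addrA addrAC.
    rewrite !phiE opprD addrACA subrr addr0 (linearB B) scalerBr.
    by rewrite !opprD !opprK addrACA.
  set d := x - z.
  rewrite -ler_sqr ?nnegrE ?mulr_ge0 ?sqrtr_ge0//.
  rewrite exprMn sqr_sqrtr ?subr_ge0// (normB_sqr ipE) normrZ (ger0_norm (ltW tau0)).
  have h1 := B_coercive d.
  have h2 : `|B d| ^+ 2 <= L ^+ 2 * `|d| ^+ 2.
    by rewrite -exprMn ler_sqr ?nnegrE ?mulr_ge0// ltW.
  rewrite (ipC (ip := ip)) ipZl exprMn.
  have e : tau * L ^+ 2 = c by rewrite /tau mulfVK// expf_neq0// gt_eqF.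
  have h3 : tau ^+ 2 * `|B d| ^+ 2 <= tau * c * `|d| ^+ 2.
    have -> : tau * c * `|d| ^+ 2 = tau ^+ 2 * (L ^+ 2 * `|d| ^+ 2).
      by rewrite -[in LHS]e; ring.
    by rewrite ler_wpM2l// sqr_ge0.
  have h4 : tau * c * `|d| ^+ 2 <= tau * ip (B d) d by rewrite -mulrA ler_pM2l.
  lra.
have phiT : set_fun [set: H] [set: H] phi by [].
pose F : {fun [set: H] >-> [set: H]} := HB.pack phi (isFun.Build _ _ _ _ phi phiT).
have cF : is_contraction F.
  exists (NngNum (sqrtr_ge0 (1 - tau * c))); split => //=.
  by move=> [x z] _ /=; exact: contr.
have [p _] := banach_fixed_point cF closedT (ex_intro _ (0 : H) I).
move=> /= e; exists p; apply/eqP; rewrite -subr_eq0.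
have {e} : p = phi p := e.
move/eqP; rewrite -subr_eq0 subKr scaler_eq0 gt_eqF//.
Qed.

(** The Lax-Milgram theorem for a bounded operator. *)
Lemma coercive_inverse : exists G : {linear H -> H},
  [/\ forall y, B (G y) = y, forall x, G (B x) = x & forall y, c * `|G y| <= `|y|].
Proof.
have Binj : injective B.
  move=> x z e; apply/eqP; rewrite -subr_eq0 -normr_le0.
  by have := coercive_lower_bound (x - z); rewrite linearB e subrr normr0 pmulr_rle0.
have [g gK] := choice coercive_onto.
have lg : linear g by move=> a x y; apply: Binj; rewrite linearP/= !gK.
have [G eG] := linear_witness lg; exists G; split=> x.
- by rewrite eG gK.
- by apply: Binj; rewrite eG gK.
- by rewrite eG -{2}(gK x) coercive_lower_bound.
Qed.

End Coercive.

(** * Log-convex sequences *)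

Section LogConvex.
Context {R : realType}.
Variable a : nat -> R.
Hypothesis a_gt0 : forall k, 0 < a k.
Hypothesis a_logconvex : forall k, a k.+1 ^+ 2 <= a k * a k.+2.

Lemma logconvex_ratio m n : (m <= n)%N -> a m.+1 / a m <= a n.+1 / a n.
Proof.
elim: n => [|n IH]; first by rewrite leqn0 => /eqP->.
rewrite leq_eqVlt => /predU1P[->//|/IH] /le_trans; apply.
by rewrite ler_pdivrMr// mulrAC ler_pdivlMr// mulrC -expr2 mulrC.
Qed.

(** The ratio [a n / a 0] is a product of n successive ratios, none larger than
    the ratio that follows them. *)
Lemma logconvex_last n : a n / a 0 <= (a n.+1 / a n) ^+ n.
Proof.
suff h k : (k <= n)%N -> a k / a 0 <= (a n.+1 / a n) ^+ k by exact: h.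
elim: k => [|k IH kn]; first by rewrite divff ?gt_eqF.
rewrite exprSr; have -> : a k.+1 / a 0 = a k / a 0 * (a k.+1 / a k).
  by field; rewrite !gt_eqF.
apply: ler_pM; rewrite ?divr_ge0 ?(ltW (a_gt0 _))//; first exact/IH/ltnW.
exact/logconvex_ratio/ltnW.
Qed.

(** The ratio [a n / a 0] is a product of n successive ratios, none smaller than
    the first one. *)
Lemma logconvex_first n : (a 1 / a 0) ^+ n <= a n / a 0.
Proof.
elim: n => [|n IH]; first by rewrite divff ?gt_eqF.
rewrite exprSr; have -> : a n.+1 / a 0 = a n / a 0 * (a n.+1 / a n).
  by field; rewrite !gt_eqF.
by apply: ler_pM => //; rewrite ?exprn_ge0 ?divr_ge0 ?(ltW (a_gt0 _))// logconvex_ratio.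
Qed.

End LogConvex.

(** * Semigroups and bounded operators *)

Section RightLimits.
Context {R : realType}.

Lemma near_right0 (P : R -> Prop) : (\forall h \near 0^'+, P h) ->
  exists2 d, 0 < d & forall h, 0 < h < d -> P h.
Proof.
move=> [d /= d0 Pd]; exists d => // h /andP[h0 hd]; apply: Pd => //=.
by rewrite sub0r normrN gtr0_norm.
Qed.

(** Only arbitrarily small arguments with [0 <= G s] are needed, which suits
    estimates known at rational times or along a sequence of step lengths. *)
Lemma right_lim_ge0 (G : R -> R) l : G s @[s --> 0^'+] --> l ->
  (forall d, 0 < d -> exists2 s, 0 < s < d & 0 <= G s) -> 0 <= l.
Proof.
move=> Gl h; rewrite leNgt; apply/negP => l0.
move/cvgrPdist_lt : Gl => /(_ (- l)); rewrite oppr_gt0 => /(_ l0).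
move=> /near_right0[d d0 Pd]; have [s sd Gs] := h _ d0.
have := Pd _ sd; rewrite distrC ltNge => /negP; apply.
by rewrite (le_trans _ (ler_norm _))//; lra.
Qed.

End RightLimits.

Section BoundedOperator.
Context {R : realType} {H : normedModType R}.

Lemma continuous_linear_bound (f : {linear H -> H}) : continuous f ->
  exists2 K : R, 0 < K & forall x, `|f x| <= K * `|x|.
Proof.
move=> fc; have := continuous_linear_bounded 0 (fc 0).
by move=> /linear_boundedP/pinfty_ex_gt0[K K0 fK]; exists K.
Qed.

Lemma op_norm_leP (f : {linear H -> H}) (c : R) : 0 <= c ->
  (op_norm f <= c%:E)%E <-> forall x, `|f x| <= c * `|x|.
Proof.
move=> c0; split=> [h x|h]; last first.
  apply: ge_ereal_sup => _ [x /= x1 <-]; rewrite lee_fin.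
  by apply: (le_trans (h x)); rewrite -[leRHS]mulr1 ler_wpM2l.
have [->|x0] := eqVneq x 0; first by rewrite linear0 normr0 mulr0.
have nx : 0 < `|x| by rewrite normr_gt0.
have : (`|f (`|x|^-1 *: x)|%:E <= c%:E)%E.
  apply: le_trans h; apply: ereal_sup_ubound; exists (`|x|^-1 *: x) => //=.
  by rewrite normrZ normfV normr_id mulVf// gt_eqF.
by rewrite lee_fin linearZ normrZ normfV normr_id mulrC ler_pdivrMr.
Qed.

End BoundedOperator.

Section Semigroup.
Context {R : realType} {H : normedModType R} {T : R -> {linear H -> H}}.
Hypothesis TC0 : C0_semigroup T.

Lemma semigroup_near0 (x : H) (e : R) : 0 < e ->
  exists2 d, 0 < d & forall h, 0 <= h < d -> `|T h x - x| < e.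
Proof.
move=> e0; have := @C0_strong _ _ _ TC0 x => /cvgrPdist_lt /(_ _ e0).
move=> /near_right0[d d0 Pd]; exists d => // h /andP[].
rewrite le_eqVlt => /predU1P[<- _|h0 hd].
  by rewrite (C0_id TC0) subrr normr0.
by rewrite distrC Pd// h0.
Qed.

Lemma semigroup_comm s t x : 0 <= s -> 0 <= t -> T s (T t x) = T t (T s x).
Proof. by move=> s0 t0; rewrite -!(C0_add TC0)// addrC. Qed.

Lemma semigroup_right_cont t x : 0 <= t -> T (t + s) x @[s --> 0^'+] --> T t x.
Proof.
move=> t0.
have h : T t (T s x) @[s --> 0^'+] --> T t x.
  by apply: continuous_cvg (@C0_strong _ _ _ TC0 x); exact: (C0_bounded TC0 t0).
apply: cvg_trans h; apply: near_eq_cvg; near=> s; rewrite (C0_add TC0)//.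
Unshelve. all: by end_near. Qed.

End Semigroup.

(** * Log-convexity of the orbits of a self-adjoint semigroup *)

Section SelfAdjointSemigroup.
Context {R : realType} {H : completeNormedModType R} {ip : {dot H for idfun}}.
Hypothesis ipE : inner_product_for ip.
Context {T : R -> {linear H -> H}}.
Hypotheses (TC0 : C0_semigroup T) (Tsa : selfadjoint_semigroup ip T).

(** Self-adjointness moves the step h from one factor of |T (t + h) x|^2 to the
    other; the rest is Cauchy-Schwarz. *)
Lemma orbit_logconvex t h x : 0 <= t -> 0 <= h ->
  `|T (t + h) x| ^+ 2 <= `|T t x| * `|T (t + h + h) x|.
Proof.
move=> t0 h0; rewrite -ipE.
have -> : T (t + h) x = T h (T t x) by rewrite addrC (C0_add TC0).
rewrite (Tsa h0) -[X in ip _ (T h X)](C0_add TC0)// -(C0_add TC0) ?addr_ge0//.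
by rewrite (_ : h + (h + t) = t + h + h) ?(cauchy_schwarz ipE)//; ring.
Qed.

Lemma orbit_seq_logconvex x h : 0 <= h -> forall k,
  `|T (k.+1%:R * h) x| ^+ 2 <= `|T (k%:R * h) x| * `|T (k.+2%:R * h) x|.
Proof.
move=> h0 k; have := orbit_logconvex x (mulr_ge0 (ler0n R k) h0) h0.
have -> : k%:R * h + h + h = k.+2%:R * h by rewrite -!natr1; ring.
by have -> : k%:R * h + h = k.+1%:R * h by rewrite -!natr1; ring.
Qed.

(** If T t x = 0, log-convexity propagates the zero down to every time t / n
    with n > 0, and T (t / n) x tends to x. *)
Lemma semigroup_neq0 t x : 0 <= t -> x != 0 -> T t x != 0.
Proof.
move=> t0 x0; apply/eqP => Ttx0.
have nx : 0 < `|x| by rewrite normr_gt0.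
have [d d0 Td] := @semigroup_near0 _ _ _ TC0 x _ nx.
(* The step h must be shorter than d, where T h x is still close to x. *)
pose n := Num.truncn (t / d); pose h := t / n.+1%:R.
have h0 : 0 <= h by rewrite divr_ge0.
have hd : h < d.
  by rewrite ltr_pdivrMr// mulrC -ltr_pdivrMr// truncnS_gt.
have down k : T (k.+1%:R * h) x = 0 -> T h x = 0.
  elim: k => [|k IH]; first by rewrite mul1r.
  move=> Tk; apply: IH.
  have := orbit_seq_logconvex x h0 k.
  rewrite Tk normr0 mulr0 real_exprn_even_le0 ?num_real// => /andP[_].
  by rewrite normr_eq0 => /eqP.
have := Td h; rewrite h0 hd => /(_ isT).
by rewrite (down n) ?sub0r ?normrN ?ltxx// mulrC divfK ?pnatr_eq0.
Qed.

End SelfAdjointSemigroup.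

(** * The growth bound *)

Section GrowthBound.
Context {R : realType} {H : completeNormedModType R} {ip : {dot H for idfun}}.
Hypothesis ipE : inner_product_for ip.
Context {T : R -> {linear H -> H}}.
Hypotheses (TC0 : C0_semigroup T) (Tsa : selfadjoint_semigroup ip T).

Lemma orbit_first_step h n x : 0 <= h -> x != 0 ->
  (`|T h x| / `|x|) ^+ n <= `|T (n%:R * h) x| / `|x|.
Proof.
move=> h0 x0; pose a k := `|T (k%:R * h) x|.
have kh k : 0 <= k%:R * h by rewrite mulr_ge0.
have apos k : 0 < a k by rewrite normr_gt0 (semigroup_neq0 ipE TC0 Tsa).
have := logconvex_first apos (orbit_seq_logconvex ipE TC0 Tsa x h0) n.
by rewrite /a mul1r mul0r (C0_id TC0).
Qed.

Variable w : R.
Hypothesis T1_le : forall x, `|T 1 x| <= expR w * `|x|.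

(** Log-convexity bounds the growth over one step of length 1 / (n + 1) by the
    corresponding root of the growth over unit time. *)
Lemma norm_root_le n x : `|T (n.+1%:R^-1) x| <= expR (w / n.+1%:R) * `|x|.
Proof.
have [->|x0] := eqVneq x 0; first by rewrite linear0 normr0 mulr0.
have nx : 0 < `|x| by rewrite normr_gt0.
rewrite -ler_pdivrMr// -(@ler_pXn2r _ n.+1)// ?nnegrE ?divr_ge0 ?expR_ge0//.
rewrite -expRM_natr divfK ?pnatr_eq0//.
have n0 : 0 <= n.+1%:R^-1 :> R by rewrite invr_ge0.
apply: le_trans (orbit_first_step n.+1 n0 x0) _.
by rewrite divff ?pnatr_eq0// ler_pdivrMr.
Qed.

Lemma norm_rational_le k n x :
  `|T (k%:R / n.+1%:R) x| <= expR (w * (k%:R / n.+1%:R)) * `|x|.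
Proof.
elim: k => [|k IH]; first by rewrite mul0r mulr0 expR0 (C0_id TC0) mul1r.
have e : k.+1%:R / n.+1%:R = n.+1%:R^-1 + k%:R / n.+1%:R :> R.
  by rewrite -natr1; ring.
rewrite e (C0_add TC0) ?invr_ge0 ?divr_ge0//.
apply: le_trans (norm_root_le _ _) _.
by rewrite mulrDr expRD -mulrA ler_wpM2l ?expR_ge0.
Qed.

(** The bound holds at rational times by the semigroup law, and reaches t from
    the right along rational times because orbits are right-continuous. *)
Lemma norm_semigroup_le t x : 0 <= t -> `|T t x| <= expR (w * t) * `|x|.
Proof.
move=> t0; rewrite -subr_ge0.
apply: (@right_lim_ge0 _ (fun s => expR (w * (t + s)) * `|x| - `|T (t + s) x|)).
  apply: cvgB; last by apply: cvg_norm; exact: semigroup_right_cont.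
  apply: cvgMl.
  have -> : expR (w * t) = expR (w * (t + 0)) by rewrite addr0.
  apply: continuous_cvg; first exact: continuous_expR.
  apply: cvgMr; apply: cvgD; first exact: cvg_cst.
  exact: cvg_at_right_filter.
(* The first multiple of 1 / (n + 1) after t, at distance less than d. *)
move=> d d0; pose n := Num.truncn d^-1; pose m := Num.truncn (t * n.+1%:R).
have n0 : 0 < n.+1%:R :> R by [].
exists (m.+1%:R / n.+1%:R - t); last first.
  by rewrite subrKC subr_ge0 norm_rational_le.
have /andP[m1 m2] : m%:R <= t * n.+1%:R < m.+1%:R by apply: truncn_itv; rewrite mulr_ge0.
rewrite subr_gt0 ltr_pdivlMr// m2/= ltrBlDr ltr_pdivrMr// mulrDl -natr1.
rewrite addrC ltr_leD// -ltr_pdivrMl// mulr1; exact: truncnS_gt.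
Qed.

Hypothesis T1_least : forall c, (forall x, `|T 1 x| <= c * `|x|) -> expR w <= c.

(** The constant M in a bound |T t| <= M e^(a t) disappears: log-convexity gives
    |T 1|^n <= M e^(a n) for every n > 0. *)
Lemma growth_boundE : growth_bound T = w%:E.
Proof.
apply/eqP; rewrite eq_le; apply/andP; split.
  apply: ereal_inf_lbound; exists w => //; exists 1 => // t t0.
  apply/op_norm_leP; first by rewrite mul1r expR_ge0.
  by move=> x; rewrite mul1r (mulrC t) norm_semigroup_le.
apply: le_ereal_inf_tmp => _ [a [M M1 Ma] <-]; rewrite lee_fin.
have M0 : 0 < M by apply: lt_le_trans M1.
have root n : expR w <= expR ((ln M + n.+1%:R * a) / n.+1%:R).
  apply: T1_least => x.
  have [->|x0] := eqVneq x 0; first by rewrite linear0 normr0 mulr0.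
  have nx : 0 < `|x| by rewrite normr_gt0.
  rewrite -ler_pdivrMr// -(@ler_pXn2r _ n.+1)// ?nnegrE ?divr_ge0 ?expR_ge0//.
  rewrite -expRM_natr divfK ?pnatr_eq0// expRD lnK//.
  apply: le_trans (orbit_first_step n.+1 ler01 x0) _.
  rewrite mulr1 ler_pdivrMr//.
  by have /op_norm_leP := Ma n.+1%:R (ler0n _ _); apply; rewrite mulr_ge0 ?expR_ge0// ltW.
have {}root n : n.+1%:R * (w - a) <= ln M.
  by have := root n; rewrite ler_expR ler_pdivlMr//; lra.
rewrite leNgt; apply/negP => aw.
have := root (Num.truncn (ln M / (w - a))).
by rewrite -ler_pdivlMr ?subr_gt0// leNgt truncnS_gt.
Qed.

End GrowthBound.

Section GrowthRate.
Context {R : realType} {H : completeNormedModType R} {ip : {dot H for idfun}}.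
Hypothesis ipE : inner_product_for ip.
Context {T : R -> {linear H -> H}}.
Hypotheses (TC0 : C0_semigroup T) (Tsa : selfadjoint_semigroup ip T).

(** The infimum of the admissible constants is positive because T 1 does not
    annihilate nonzero vectors, so it has a logarithm. *)
Lemma exists_growth_rate : (exists x : H, x != 0) -> exists w : R,
  (forall x, `|T 1 x| <= expR w * `|x|) /\
  (forall c, (forall x, `|T 1 x| <= c * `|x|) -> expR w <= c).
Proof.
move=> [x0 x0N].
have nx : 0 < `|x0| by rewrite normr_gt0.
have [K K0 TK] := continuous_linear_bound (C0_bounded TC0 ler01).
pose S : set R := [set c | forall x, `|T 1 x| <= c * `|x|].
have Slb : lbound S (`|T 1 x0| / `|x0|) by move=> c Sc; rewrite ler_pdivrMr.
have S0 : S !=set0 by exists K.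
have infS : has_inf S by split => //; exists (`|T 1 x0| / `|x0|).
have inf_gt0 : 0 < inf S.
  apply: lt_le_trans (lb_le_inf S0 Slb).
  by rewrite divr_gt0// normr_gt0 (semigroup_neq0 ipE TC0 Tsa).
exists (ln (inf S)); rewrite lnK//; split; last first.
  by move=> c Sc; apply: ge_inf => //; case: infS.
move=> x; have [->|xN] := eqVneq x 0; first by rewrite linear0 normr0 mulr0.
rewrite -ler_pdivrMr ?normr_gt0//; apply: lb_le_inf => // c Sc.
by rewrite ler_pdivrMr ?normr_gt0.
Qed.

End GrowthRate.

(** * Riemann sums of a contraction semigroup *)

Section ErgodicMeans.
Context {R : realType} {H : completeNormedModType R} {U : R -> {linear H -> H}}.
Hypotheses (UC0 : C0_semigroup U) (U_le : forall t x, 0 <= t -> `|U t x| <= `|x|).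

(** For [h = 1 / m] these are the left Riemann sums of the orbit of x over the
    interval [0, 1]. *)
Definition mean (h : R) (m : nat) (x : H) : H :=
  m%:R^-1 *: \sum_(i < m) U (i%:R * h) x.

Lemma meanB h m x y : mean h m (x - y) = mean h m x - mean h m y.
Proof.
rewrite /mean -scalerBr -sumrB; congr (_ *: _).
by apply: eq_bigr => i _; rewrite linearB.
Qed.

Lemma mean_le h m x e : 0 <= e ->
  (forall i, (i < m)%N -> `|U (i%:R * h) x| <= e) -> `|mean h m x| <= e.
Proof.
move=> e0 xe; have [->|m0] := posnP m.
  by rewrite /mean invr0 scale0r normr0.
rewrite /mean normrZ normfV normr_nat mulrC ler_pdivrMr ?ltr0n//.
apply: le_trans (ler_norm_sum _ _ _) _.
apply: le_trans (ler_sum _ (fun (i : 'I_m) _ => xe i (ltn_ord i))) _.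
by rewrite sumr_const card_ord mulr_natr.
Qed.

Lemma mean_dist h m x e : 0 <= e -> (0 < m)%N ->
  (forall i, (i < m)%N -> `|U (i%:R * h) x - x| <= e) -> `|mean h m x - x| <= e.
Proof.
move=> e0 m0 xe.
have -> : mean h m x - x = m%:R^-1 *: \sum_(i < m) (U (i%:R * h) x - x).
  rewrite sumrB scalerBr sumr_const card_ord -(scaler_nat m x) scalerA mulVf ?scale1r//.
  by rewrite pnatr_eq0 -lt0n.
rewrite normrZ normfV normr_nat mulrC ler_pdivrMr ?ltr0n//.
apply: le_trans (ler_norm_sum _ _ _) _.
apply: le_trans (ler_sum _ (fun (i : 'I_m) _ => xe i (ltn_ord i))) _.
by rewrite sumr_const card_ord mulr_natr.
Qed.

Lemma mean_contraction h m x : 0 <= h -> `|mean h m x| <= `|x|.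
Proof. by move=> h0; apply: mean_le => // i _; rewrite U_le// mulr_ge0. Qed.

(** Refining a subdivision amounts to replacing x by its own mean over one cell;
    this compares a Riemann sum with a finer one. *)
Lemma mean_mul h n m x : 0 <= h ->
  mean h (n * m) x = mean (m%:R * h) n (mean h m x).
Proof.
move=> h0; rewrite /mean natrM invfM -scalerA; congr (_ *: _).
under [RHS]eq_bigr => j _ do rewrite linearZ.
rewrite -scaler_sumr; congr (_ *: _).
elim: n => [|n IH]; first by rewrite !big_ord0.
rewrite mulSnr big_split_ord/= IH big_ord_recr/=; congr (_ + _).
rewrite linear_sum; apply: eq_bigr => i _ /=.
rewrite -(C0_add UC0) ?mulr_ge0//; congr (U _ x).
by rewrite natrD natrM; ring.
Qed.

Lemma semigroup_telescope h m x : 0 <= h ->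
  x - U (m%:R * h) x = \sum_(i < m) U (i%:R * h) (x - U h x).
Proof.
move=> h0; elim: m => [|m IH].
  by rewrite big_ord0 mul0r (C0_id UC0) subrr.
rewrite big_ord_recr/= -IH linearB -(C0_add UC0) ?mulr_ge0// addrA subrK.
by congr (_ - U _ x); rewrite -natr1; ring.
Qed.

(** The discrete form of the fundamental theorem of calculus for orbits. *)
Lemma mean_telescope h m x : 0 <= h ->
  mean h m x - U h (mean h m x) = m%:R^-1 *: (x - U (m%:R * h) x).
Proof.
move=> h0; rewrite /mean linearZ -scalerBr semigroup_telescope//.
rewrite linear_sum -sumrB; congr (_ *: _); apply: eq_bigr => i _.
by rewrite linearB (semigroup_comm UC0)// mulr_ge0.
Qed.

(** Two subdivisions are compared through their common refinement. As U
    contracts, the modulus of continuity of the orbit of x is at most its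
    modulus at time 0, so the error over one cell is controlled by
    [semigroup_near0]. *)
Lemma riemann_sum_cvg x : cvg (mean n.+1%:R^-1 n.+1 x @[n --> \oo]).
Proof.
pose J n := mean n.+1%:R^-1 n.+1 x.
have Jmul n m d e : (forall h, 0 <= h < d -> `|U h x - x| < e) -> 0 < e ->
    n.+1%:R^-1 < d -> `|mean (n.+1 * m.+1)%:R^-1 (n.+1 * m.+1) x - J n| <= e.
  move=> xd e0 nd; have h0 : 0 <= (n.+1 * m.+1)%:R^-1 :> R by rewrite invr_ge0.
  rewrite mean_mul//.
  have -> : m.+1%:R * (n.+1 * m.+1)%:R^-1 = n.+1%:R^-1 :> R.
    by rewrite natrM invfM mulrCA divff ?mulr1 ?pnatr_eq0.
  rewrite /J -meanB; apply: le_trans (mean_contraction _ _ _) _ => //.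
  apply: mean_dist => //; first exact: ltW.
  move=> i im; apply/ltW/xd; rewrite mulr_ge0//=; apply: le_lt_trans nd.
  rewrite natrM invfM mulrCA ler_piMr// ler_pdivrMr// mul1r ler_nat.
  exact: ltnW.
apply/cauchy_cvgP/cauchyP => e e0.
have [d d0 xd] := @semigroup_near0 _ _ _ UC0 x (e / 4) (divr_gt0 e0 (ltr0n _ 4)).
have e4 : 0 < e / 4 by rewrite divr_gt0.
pose N := Num.truncn d^-1.
have ND : N.+1%:R^-1 < d by rewrite invf_plt ?posrE//; exact: truncnS_gt.
suff JN : \forall n \near \oo, `|J N - J n| < e.
  by exists (J N); apply: filterS JN => n; rewrite -ball_normE.
near=> n.
have nd : n.+1%:R^-1 < d.
  apply: le_lt_trans ND; rewrite lef_pV2 ?posrE// ler_nat ltnS.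
  by near: n; exact: nbhs_infty_ge.
have h1 := Jmul N n d _ xd e4 ND.
have h2 := Jmul n N d _ xd e4 nd.
rewrite mulnC in h2.
rewrite -(subrKA (mean (N.+1 * n.+1)%:R^-1 (N.+1 * n.+1) x)).
apply: le_lt_trans (ler_normD _ _) _.
by rewrite (distrC (J N)); lra.
Unshelve. all: by end_near. Qed.

End ErgodicMeans.

(** The decomposition of the error in [riemann_lim_orbit]. *)
Lemma five_step_telescope (V : zmodType) (l J a b c s t : V) :
  l - c - s = (l - J) + (J - a - t) + (a - b) + (b - c) - (s - t).
Proof.
rewrite -(addrA J) (subrKA J l) (addrA l) (addrAC l (- a)) !subrKA opprB.
by rewrite (addrAC l (- t)) subrKA.
Qed.

Section RiemannSums.
Context {R : realType} {H : completeNormedModType R} {U : R -> {linear H -> H}}.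
Hypotheses (UC0 : C0_semigroup U) (U_le : forall t x, 0 <= t -> `|U t x| <= `|x|).

(** With l the integral of U s x over [0, 1], the difference l - U h l is the
    integral of U s (x - U 1 x) over [0, h], hence within h e of h (x - U 1 x).
    At the discrete level h is replaced by the largest multiple m k of the mesh
    k = 1 / (n + 1) below it, where the identity is exact; contractivity of U
    controls what remains. *)
Lemma riemann_lim_orbit x l h e : 0 <= h -> 0 <= e ->
  mean (U := U) n.+1%:R^-1 n.+1 x @[n --> \oo] --> l ->
  (forall r, 0 <= r <= h -> `|U r (x - U 1 x) - (x - U 1 x)| <= e) ->
  `|l - U h l - h *: (x - U 1 x)| <= h * e.
Proof.
move=> h0 e0 Jl; set z := x - U 1 x => ze.
apply/ler_addgt0Pr => eps eps0.
(* Besides the main error h e there are four: three of size eta, one eta |z|. *)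
pose eta := eps / (3 + `|z|).
have z3 : 0 < 3 + `|z| by rewrite ltr_wpDr.
have eta0 : 0 < eta by rewrite divr_gt0.
have [d d0 ld] := @semigroup_near0 _ _ _ UC0 l eta eta0.
near \oo => n.
have kd : n.+1%:R^-1 < d.
  rewrite invf_plt ?posrE//; apply: lt_le_trans (truncnS_gt _) _.
  by rewrite ler_nat ltnS; near: n; exact: nbhs_infty_ge.
have keta : n.+1%:R^-1 <= eta.
  rewrite invf_ple ?posrE//; apply/ltW; apply: lt_le_trans (truncnS_gt _) _.
  by rewrite ler_nat ltnS; near: n; exact: nbhs_infty_ge.
have Jeta : `|l - mean (U := U) n.+1%:R^-1 n.+1 x| < eta.
  by near: n; move/cvgrPdist_lt : Jl; exact.
pose m := Num.truncn (h * n.+1%:R).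
set k : R := n.+1%:R^-1 in kd keta Jeta *; set J := mean _ _ x in Jeta *.
have k0 : 0 <= k by rewrite invr_ge0.
have m1 : m%:R * k <= h.
  by rewrite ler_pdivrMr ?ltr0n// truncn_le mulr_ge0.
have m2 : h - m%:R * k < k.
  rewrite ltrBlDr -[X in X + _]mul1r -mulrDl ltr_pdivlMr ?ltr0n// addrC natr1.
  exact: truncnS_gt.
have mk0 : 0 <= m%:R * k by rewrite mulr_ge0.
have core : `|J - U (m%:R * k) J - (m%:R * k) *: z| <= h * e.
  apply: (@le_trans _ _ (m%:R * k * e)); last by rewrite ler_wpM2r.
  rewrite (semigroup_telescope UC0)// (mean_telescope UC0)// /k.
  rewrite divff ?pnatr_eq0// -/k -/z.
  have -> : \sum_(i < m) U (i%:R * k) (k *: z) - (m%:R * k) *: z =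
      k *: \sum_(i < m) (U (i%:R * k) z - z).
    rewrite sumrB [in RHS]scalerBr sumr_const card_ord -(scaler_nat m z).
    rewrite [in RHS]scalerA (mulrC k).
    by congr (_ - _); rewrite scaler_sumr; apply: eq_bigr => i _; rewrite linearZ.
  rewrite normrZ (ger0_norm k0) mulrAC mulrC ler_wpM2r//.
  apply: le_trans (ler_norm_sum _ _ _) _.
  have ze' (i : 'I_m) : true -> `|U (i%:R * k) z - z| <= e.
    move=> _; apply: ze; rewrite mulr_ge0//=; apply: le_trans m1.
    by rewrite ler_wpM2r// ler_nat ltnW.
  by apply: le_trans (ler_sum _ ze') _; rewrite sumr_const card_ord mulr_natl.
have -> : l - U h l - h *: z = (l - J) + (J - U (m%:R * k) J - (m%:R * k) *: z)
    + U (m%:R * k) (J - l) + U (m%:R * k) (l - U (h - m%:R * k) l)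
    - (h - m%:R * k) *: z.
  rewrite !(linearB (U (m%:R * k))) -(C0_add UC0) ?subr_ge0// subrKC scalerBl.
  exact: five_step_telescope.
have b1 : `|U (m%:R * k) (J - l)| <= eta.
  by rewrite (le_trans (U_le _ mk0))// distrC ltW.
have b2 : `|U (m%:R * k) (l - U (h - m%:R * k) l)| <= eta.
  apply: le_trans (U_le _ mk0) _; rewrite distrC; apply/ltW/ld.
  by rewrite subr_ge0 m1 (lt_trans m2).
have b3 : `|(h - m%:R * k) *: z| <= eta * `|z|.
  rewrite normrZ ger0_norm ?subr_ge0// ler_wpM2r//.
  by rewrite (le_trans (ltW m2)).
have -> : eps = eta + eta + eta + eta * `|z|.
  by rewrite /eta; field; rewrite gt_eqF.
apply: le_trans (ler_normB _ _) _; apply: le_trans (lerD (ler_normD _ _) b3) _.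
have := ler_normD (l - J + (J - U (m%:R * k) J - m%:R * k *: z)) (U (m%:R * k) (J - l)).
have := ler_normD (l - J) (J - U (m%:R * k) J - m%:R * k *: z).
lra.
Unshelve. all: by end_near. Qed.

End RiemannSums.

(** * The generator *)

(** Squeezed between a and a e^(a h): both bounds come from 1 + x <= e^x,
    applied to a h and to - a h. *)
Lemma expR_diff_quotient (R : realType) (a : R) :
  h^-1 * (expR (a * h) - 1) @[h --> 0^'+] --> a.
Proof.
apply: (squeeze_cvgr (f := fun=> a) (h := fun h => a * expR (a * h))).
- near=> h; have h0 : 0 < h by near: h; exact: nbhs_right_gt.
  rewrite (mulrC h^-1) ler_pdivlMr// ler_pdivrMr//.
  have e0 : 0 < expR (a * h) := expR_gt0 _.
  have h1 := expR_ge1Dx (a * h); have h2 := expR_ge1Dx (- (a * h)).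
  have h3 : expR (a * h) * expR (- (a * h)) = 1 by rewrite -expRD subrr expR0.
  have h4 : expR (a * h) * (1 + - (a * h)) <= 1 by rewrite -[leRHS]h3 ler_pM2l.
  by apply/andP; split; lra.
- exact: cvg_cst.
- rewrite -[X in _ --> X]mulr1; apply: cvgMr.
  rewrite -[X in _ --> X]expR0; apply: continuous_cvg; first exact: continuous_expR.
  rewrite -[X in _ --> X](mulr0 a); apply: cvgMr.
  exact: cvg_at_right_filter.
Unshelve. all: by end_near. Qed.

Section Generator.
Context {R : realType} {H : normedModType R} {T : R -> {linear H -> H}}.
Hypothesis TC0 : C0_semigroup T.
Let A := generator T.

Lemma generatorP x y : h^-1 *: (T h x - x) @[h --> 0^'+] --> y ->
  op_dom A x /\ op_fun A x = y.
Proof. by move=> xy; split; [exact: cvgP xy | exact: cvg_lim xy]. Qed.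

Lemma generator_cvg x : op_dom A x ->
  h^-1 *: (T h x - x) @[h --> 0^'+] --> op_fun A x.
Proof. by []. Qed.

Lemma generator_linear c x y : op_dom A x -> op_dom A y ->
  op_dom A (c *: x + y) /\ op_fun A (c *: x + y) = c *: op_fun A x + op_fun A y.
Proof.
move=> xA yA; apply: generatorP.
have lim_h : c *: (h^-1 *: (T h x - x)) + h^-1 *: (T h y - y) @[h --> 0^'+]
    --> c *: op_fun A x + op_fun A y.
  by apply: cvgD; [apply: cvgZl_tmp; exact: generator_cvg | exact: generator_cvg].
apply: cvg_trans lim_h; apply: near_eq_cvg; near=> h => /=.
rewrite linearP scalerA mulrC -scalerA -scalerDr; congr (_ *: _).
by rewrite scalerBr opprD addrACA.
Unshelve. all: by end_near. Qed.

Lemma generator0 : op_dom A 0 /\ op_fun A 0 = 0.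
Proof.
apply: generatorP; apply: cvg_near_cst; near=> h.
by rewrite linear0 subrr scaler0.
Unshelve. all: by end_near. Qed.

Lemma generatorZ c x : op_dom A x ->
  op_dom A (c *: x) /\ op_fun A (c *: x) = c *: op_fun A x.
Proof.
move=> xA; have [A0 e0] := generator0.
by have := generator_linear c xA A0; rewrite e0 !addr0.
Qed.

Lemma generator_domB x y : op_dom A x -> op_dom A y -> op_dom A (x - y).
Proof.
by move=> xA yA; have [] := generator_linear (-1) yA xA; rewrite scaleN1r addrC.
Qed.

Lemma generator_dom_semigroup t x : 0 <= t -> op_dom A x -> op_dom A (T t x).
Proof.
move=> t0 xA; apply: (proj1 (@generatorP _ (T t (op_fun A x)) _)).
have lim_h : T t (h^-1 *: (T h x - x)) @[h --> 0^'+] --> T t (op_fun A x).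
  by apply: continuous_cvg (generator_cvg xA); exact: (@C0_bounded _ _ _ TC0).
apply: cvg_trans lim_h; apply: near_eq_cvg; near=> h => /=.
by rewrite linearZ linearB (semigroup_comm TC0).
Unshelve. all: by end_near. Qed.

End Generator.

Section SymmetricGenerator.
Context {R : realType} {H : completeNormedModType R} {ip : {dot H for idfun}}.
Hypothesis ipE : inner_product_for ip.
Context {T : R -> {linear H -> H}}.
Hypotheses (TC0 : C0_semigroup T) (Tsa : selfadjoint_semigroup ip T).
Let A := generator T.

Lemma ip_cvg (F : set_system R) (FF : Filter F) (f : R -> H) y z :
  f h @[h --> F] --> y -> ip (f h) z @[h --> F] --> ip y z.
Proof.
move=> fy; apply/subr_cvg0/norm_cvg0P.
apply: (squeeze_cvgr (f := fun=> 0) (h := fun h => `|f h - y| * `|z|)).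
- near=> h; rewrite normr_ge0/= -(ipNl (ip := ip)) -ipDl.
  exact: cauchy_schwarz_abs.
- exact: cvg_cst.
- rewrite -[X in _ --> X](mul0r `|z|); apply: cvgMl.
  rewrite -(normr0 H); apply: cvg_norm.
  by apply/subr_cvg0.
Unshelve. all: by end_near. Qed.

Lemma generator_symmetric x y : op_dom A x -> op_dom A y ->
  ip (op_fun A x) y = ip x (op_fun A y).
Proof.
move=> xA yA; rewrite [RHS](ipC (ip := ip)).
have h1 : ip (h^-1 *: (T h x - x)) y @[h --> 0^'+] --> ip (op_fun A x) y.
  exact: ip_cvg (generator_cvg xA).
have h2 : ip (h^-1 *: (T h x - x)) y @[h --> 0^'+] --> ip (op_fun A y) x.
  have h3 : ip (h^-1 *: (T h y - y)) x @[h --> 0^'+] --> ip (op_fun A y) x.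
    exact: ip_cvg (generator_cvg yA).
  apply: cvg_trans h3; apply: near_eq_cvg; near=> h.
  have h0 : 0 <= h by near: h; exact: nbhs_right_ge.
  by rewrite !ip_lin (Tsa h0 y) (ipC (ip := ip) y (T h x)) (ipC (ip := ip) y x).
have <- := cvg_lim (@norm_hausdorff _ _) h1.
by have <- := cvg_lim (@norm_hausdorff _ _) h2.
Unshelve. all: by end_near. Qed.

Variable w : R.
Hypothesis T_le : forall t x, 0 <= t -> `|T t x| <= expR (w * t) * `|x|.

(** The function h |-> (T h x | x) is at most e^(w h) |x|^2 with equality at h =
    0; compare the right derivatives at 0. *)
Lemma generator_le x : op_dom A x -> ip (op_fun A x) x <= w * `|x| ^+ 2.
Proof.
move=> xA; rewrite -subr_ge0.
apply: (@right_lim_ge0 _ (fun h => h^-1 * (expR (w * h) - 1) * `|x| ^+ 2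
  - ip (h^-1 *: (T h x - x)) x)).
  apply: cvgB; last exact: ip_cvg (generator_cvg xA).
  by apply: cvgMl; exact: expR_diff_quotient.
move=> d d0; exists (d / 2); first by rewrite divr_gt0// ltr_pdivrMr// ltr_pMr// ltr1n.
set h := d / 2; have h0 : 0 < h by rewrite divr_gt0.
rewrite !ip_lin -mulrA -mulrBr mulr_ge0 ?invr_ge0 ?(ltW h0)// ipE.
have := T_le x (ltW h0) => /(ler_wpM2r (normr_ge0 x)).
have := cauchy_schwarz ipE (T h x) x.
by rewrite expr2; lra.
Qed.

(** Numerical range estimate: (a - w) |x|^2 <= ((a - A) x | x). *)
Lemma generator_lower_bound a x : w < a -> op_dom A x ->
  (a - w) * `|x| <= `|a *: x - op_fun A x|.
Proof.
move=> wa xA; have [->|x0] := eqVneq x 0; first by rewrite normr0 mulr0.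
have nx : 0 < `|x| by rewrite normr_gt0.
rewrite -(ler_pM2r nx); apply: le_trans (cauchy_schwarz ipE _ _).
rewrite !ip_lin ipE -mulrA -expr2 mulrBl.
by have := generator_le xA; lra.
Qed.

End SymmetricGenerator.

(** * Real resolvents *)

Section RealResolvent.
Context {R : realType} {H : completeNormedModType R} {ip : {dot H for idfun}}.
Hypothesis ipE : inner_product_for ip.
Context {T : R -> {linear H -> H}}.
Hypotheses (TC0 : C0_semigroup T) (Tsa : selfadjoint_semigroup ip T).
Variables (w a : R).
Hypothesis T_le : forall t x, 0 <= t -> `|T t x| <= expR (w * t) * `|x|.
Hypothesis wa : w < a.
Let A := generator T.

Let U (t : R) : {linear H -> H} := expR (- (a * t)) \*: T t.

Let UE t x : U t x = expR (- (a * t)) *: T t x.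
Proof. by []. Qed.

Let UC0 : C0_semigroup U.
Proof.
split.
- move=> t t0 x; apply: cvgZl_tmp; exact: (@C0_bounded _ _ _ TC0).
- by move=> x; rewrite UE mulr0 oppr0 expR0 scale1r (C0_id TC0).
- move=> s t s0 t0 x; rewrite !UE (C0_add TC0)// [T s (_ *: _)]linearZ/= scalerA -expRD.
  by congr (expR _ *: _); ring.
- move=> x; rewrite -[X in _ --> X]scale1r; apply: cvgZ; last exact: (@C0_strong _ _ _ TC0).
  rewrite -[X in _ --> X]expR0; apply: continuous_cvg; first exact: continuous_expR.
  rewrite -[X in _ --> X]oppr0; apply: cvgN.
  rewrite -[X in _ --> X](mulr0 a); apply: cvgMr.
  exact: cvg_at_right_filter.
Qed.

Let U_decay t x : 0 <= t -> `|U t x| <= expR ((w - a) * t) * `|x|.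
Proof.
move=> t0; rewrite UE normrZ ger0_norm ?expR_ge0// mulrBl addrC expRD -mulrA.
by rewrite ler_wpM2l ?expR_ge0// T_le.
Qed.

Let U_le t x : 0 <= t -> `|U t x| <= `|x|.
Proof.
move=> t0; apply: le_trans (U_decay x t0) _.
by rewrite ler_piMl// -expR0 ler_expR mulr_le0_ge0// subr_le0 ltW.
Qed.

Let one_sub_U1_onto y : exists g, g - U 1 g = y.
Proof.
have lB : linear (fun x => x - U 1 x).
  by move=> c x z; rewrite linearP scalerBr opprD addrACA.
have [B BE] := linear_witness lB.
have q1 : expR (w - a) < 1 by rewrite -expR0 ltr_expR subr_lt0.
have Bb x : `|B x| <= 2 * `|x|.
  rewrite BE (le_trans (ler_normB _ _))// mulrDl mul1r lerD2l.
  exact: U_le.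
have Bc x : (1 - expR (w - a)) * `|x| ^+ 2 <= ip (B x) x.
  rewrite BE ipDl ipNl ipE mulrBl mul1r lerD2l lerN2 [in leRHS]expr2 mulrA.
  apply: le_trans (cauchy_schwarz ipE _ _) _; rewrite ler_wpM2r//.
  by rewrite -[w - a]mulr1 U_decay.
have c0 : 0 < 1 - expR (w - a) by rewrite subr_gt0.
by have [g Bg] := coercive_onto ipE c0 Bb Bc y; exists g; rewrite -BE.
Qed.

(** Let g solve (1 - U 1) g = y. The limit l of the Riemann sums of the orbit of
    g has right derivative - y under U by [riemann_lim_orbit], and undoing the
    factor e^(- a t) adds a l to it. *)
Lemma resolvent_onto y : exists x, op_dom A x /\ a *: x - op_fun A x = y.
Proof.
have [g gy] := one_sub_U1_onto y.
have [l gl] : exists l : H, mean (U := U) n.+1%:R^-1 n.+1 g @[n --> \oo] --> l.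
  by exists (lim (mean (U := U) n.+1%:R^-1 n.+1 g @[n --> \oo])); exact: riemann_sum_cvg.
have Ul : h^-1 *: (U h l - l) @[h --> 0^'+] --> - y.
  apply/cvgrPdist_le => e e0.
  have [d d0 yd] := @semigroup_near0 _ _ _ UC0 y e e0.
  near=> h.
  have h0 : 0 < h by near: h; exact: nbhs_right_gt.
  have hd : h < d by near: h; exact: nbhs_right_lt.
  have -> : - y - h^-1 *: (U h l - l) = h^-1 *: (l - U h l - h *: y).
    rewrite -scalerN opprB [in RHS]scalerBr (scalerA h^-1 h y).
    by rewrite mulVf ?gt_eqF// scale1r addrC.
  rewrite normrZ normfV (gtr0_norm h0) mulrC ler_pdivrMr// mulrC.
  rewrite -gy; apply: riemann_lim_orbit (ltW h0) (ltW e0) gl _ => //.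
  move=> r /andP[r0 rh]; rewrite gy; apply/ltW/yd.
  by rewrite r0 (le_lt_trans rh).
have Tl : h^-1 *: (T h l - l) @[h --> 0^'+] --> 1 *: (- y) + a *: l.
  have h1 : expR (a * h) *: (h^-1 *: (U h l - l)) + (h^-1 * (expR (a * h) - 1)) *: l
      @[h --> 0^'+] --> 1 *: (- y) + a *: l.
    apply: cvgD; last by apply: cvgZr_tmp; exact: expR_diff_quotient.
    apply: cvgZ => //.
    rewrite -[X in _ --> X]expR0; apply: continuous_cvg; first exact: continuous_expR.
    rewrite -[X in _ --> X](mulr0 a); apply: cvgMr.
    exact: cvg_at_right_filter.
  apply: cvg_trans h1; apply: near_eq_cvg; near=> h.
  have swap (c d : R) (z : H) : c *: (d *: z) = d *: (c *: z).
    by rewrite !scalerA mulrC.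
  rewrite (swap (expR (a * h)) h^-1) -(scalerA h^-1) -scalerDr; congr (_ *: _).
  rewrite scalerBr UE scalerA -expRD subrr expR0 scale1r scalerBl scale1r.
  by rewrite addrA subrK.
have [lA Al] := generatorP Tl; exists l; split => //; rewrite /A Al.
by rewrite scale1r opprD opprK addrCA subrr addr0.
Unshelve. all: by end_near. Qed.

(** Write x = (a - A) z. The vectors a z - h^-1 (T h z - z) belong to the
    domain, which is invariant under T h, and tend to x. *)
Lemma generator_dense x e : 0 < e -> exists2 y, op_dom A y & `|x - y| < e.
Proof.
move=> e0; have [z [zA zx]] := resolvent_onto x.
have zl : a *: z - h^-1 *: (T h z - z) @[h --> 0^'+] --> x.
  by rewrite -[X in _ --> X]zx; apply: cvgB; [exact: cvg_cst | exact: generator_cvg].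
near (0 : R)^'+ => h.
exists (a *: z - h^-1 *: (T h z - z)); last first.
  by near: h; move/cvgrPdist_lt : zl; exact.
have h0 : 0 <= h by near: h; exact: nbhs_right_ge.
apply: generator_domB; first exact: (proj1 (generatorZ _ zA)).
apply: (proj1 (generatorZ _ _)).
by apply: generator_domB => //; exact: (generator_dom_semigroup TC0).
Unshelve. all: by end_near. Qed.

(** By [generator_lower_bound] the solution given by [resolvent_onto] is unique;
    linearity, boundedness and symmetry of the solution operator all follow. *)
Lemma real_resolvent : exists Q : {linear H -> H},
  [/\ forall y, op_dom A (Q y) /\ a *: Q y - op_fun A (Q y) = y,
      forall x, op_dom A x -> Q (a *: x - op_fun A x) = x,
      forall y, (a - w) * `|Q y| <= `|y| &
      forall x y, ip (Q x) y = ip x (Q y)].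
Proof.
have [f fP] := choice resolvent_onto.
have f_uniq x y : op_dom A x -> a *: x - op_fun A x = y -> f y = x.
  move=> xA xy; have [fA fy] := fP y; apply/eqP.
  have [dA de] := generator_linear (-1) fA xA.
  rewrite eq_sym -subr_eq0 -normr_le0 addrC -scaleN1r.
  rewrite -(pmulr_rle0 _ (_ : 0 < a - w)) ?subr_gt0//.
  apply: le_trans (generator_lower_bound ipE T_le wa dA) _; rewrite de.
  by rewrite !scaleN1r scalerDr scalerN opprD addrACA -opprD fy xy addNr normr0.
have fl : linear f.
  move=> c x y; have [xA ex] := fP x; have [yA ey] := fP y.
  have [zA ez] := generator_linear c xA yA.
  apply: f_uniq => //; rewrite ez scalerDr scalerA mulrC -scalerA opprD addrACA.
  by rewrite -scalerBr ex ey.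
have [Q QE] := linear_witness fl; exists Q; split.
- by move=> y; rewrite QE.
- by move=> x xA; rewrite QE; exact: f_uniq.
- move=> y; rewrite QE; have [yA {2}<-] := fP y.
  exact: (generator_lower_bound ipE T_le).
- move=> x y; rewrite !QE; have [xA ex] := fP x; have [yA ey] := fP y.
  rewrite -{2}ex -{1}ey !ip_lin.
  by rewrite (generator_symmetric ipE Tsa xA yA).
Qed.

End RealResolvent.

(** * Decay of the semigroup from bounds on the generator *)

Section NumericalBound.
Context {R : realType} {H : completeNormedModType R} {ip : {dot H for idfun}}.
Hypothesis ipE : inner_product_for ip.
Context {T : R -> {linear H -> H}}.
Hypotheses (TC0 : C0_semigroup T) (Tsa : selfadjoint_semigroup ip T).
Let A := generator T.

Lemma dense_norm_bound (f : {linear H -> H}) (S : set H) c : continuous f ->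
  0 <= c -> (forall x e, 0 < e -> exists2 y, S y & `|x - y| < e) ->
  (forall y, S y -> `|f y| <= c * `|y|) -> forall x, `|f x| <= c * `|x|.
Proof.
move=> /continuous_linear_bound[K K0 fK] c0 Sd fS x.
apply/ler_addgt0Pr => e e0.
have [y Sy xy] := Sd x (e / (c + K)) (divr_gt0 e0 (ltr_wpDl c0 K0)).
have cK : (c + K) * `|x - y| <= e.
  by rewrite mulrC -ler_pdivlMr ?ltr_wpDl// ltW.
have h1 : `|f x| <= `|f y| + K * `|x - y|.
  have -> : f x = f y + f (x - y) by rewrite linearB subrKC.
  by rewrite (le_trans (ler_normD _ _))// lerD2l.
have h2 := fS _ Sy.
have h3 : c * `|y| <= c * (`|x| + `|x - y|).
  by rewrite ler_wpM2l//; have := ler_normB x (x - y); rewrite subKr.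
by lra.
Qed.

(** Log-convexity read at the end of the orbit: the decay over the whole time is
    at least as good as the one announced by the last step. *)
Lemma orbit_last_step h n x : 0 <= h -> x != 0 ->
  `|T (n%:R * h) x| / `|x| <= (`|T h (T (n%:R * h) x)| / `|T (n%:R * h) x|) ^+ n.
Proof.
move=> h0 x0; pose a k := `|T (k%:R * h) x|.
have kh k : 0 <= k%:R * h by rewrite mulr_ge0.
have apos k : 0 < a k by rewrite normr_gt0 (semigroup_neq0 ipE TC0 Tsa).
have := logconvex_last apos (orbit_seq_logconvex ipE TC0 Tsa x h0) n.
rewrite /a mul0r (C0_id TC0) -(C0_add TC0)//.
by have -> : n.+1%:R * h = h + n%:R * h by rewrite -natr1; ring.
Qed.

Variable w : R.
Hypothesis T_le : forall t x, 0 <= t -> `|T t x| <= expR (w * t) * `|x|.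

(** Fix x in the domain. The right derivative of |T t x|^2 at t = 1 is 2 (A y |
    y) with y = T 1 x, so the last of many short steps from 0 to 1 has ratio at
    most e^(c' h); by [orbit_last_step] the whole orbit decays by e^c'. Density
    of the domain gives all x. *)
Lemma decay_of_numerical_bound c c' : c < c' ->
  (forall x, op_dom A x -> ip (op_fun A x) x <= c * `|x| ^+ 2) ->
  forall x, `|T 1 x| <= expR c' * `|x|.
Proof.
move=> cc' Ac; apply: (@dense_norm_bound _ (op_dom A)).
- exact: (@C0_bounded _ _ _ TC0).
- exact: expR_ge0.
- have ww : w < w + 1 by rewrite ltrDl.
  by move=> x e; exact: (generator_dense ipE TC0 T_le ww).
move=> x xA; have [->|x0] := eqVneq x 0; first by rewrite linear0 normr0 mulr0.
set y := T 1 x.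
have yA : op_dom A y by exact: (generator_dom_semigroup TC0).
have y0 : y != 0 by exact: (semigroup_neq0 ipE TC0 Tsa).
have nx : 0 < `|x| by rewrite normr_gt0.
have ny : 0 < `|y| by rewrite normr_gt0.
have lim_y : ip (h^-1 *: (T h y - y)) y @[h --> 0^'+] --> ip (op_fun A y) y.
  exact: ip_cvg (generator_cvg yA).
have gap : 0 < (c' - c) * `|y| ^+ 2 by rewrite mulr_gt0 ?subr_gt0 ?exprn_gt0.
have /near_right0[d d0 dP] : \forall h \near 0^'+,
    ip (h^-1 *: (T h y - y)) y <= c' * `|y| ^+ 2.
  near=> h.
  have : `|ip (op_fun A y) y - ip (h^-1 *: (T h y - y)) y| < (c' - c) * `|y| ^+ 2.
    by near: h; move/cvgrPdist_lt : lim_y; exact.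
  have := Ac _ yA; rewrite distrC => h1 /(le_lt_trans (ler_norm _)).
  lra.
(* The bound is needed at h + h, because |T h y|^2 = (T (h + h) y | y). *)
pose n := Num.truncn (2 / d); pose h : R := n.+1%:R^-1.
have h0 : 0 < h by rewrite invr_gt0.
have hd : 0 < h + h < d.
  rewrite addr_gt0//= -mulr2n -mulr_natl ltr_pdivrMr// mulrC -ltr_pdivrMr//.
  exact: truncnS_gt.
have n1 : n.+1%:R * h = 1 by rewrite divff ?pnatr_eq0.
have step : `|T h y| / `|y| <= expR (c' * h).
  rewrite ler_pdivrMr// -ler_sqr ?nnegrE ?mulr_ge0 ?expR_ge0//.
  have := dP _ hd; have /andP[hh0 _] := hd.
  rewrite ipZl mulrC ler_pdivrMr// ipDl ipNl ipE (C0_add TC0) ?(ltW h0)//.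
  rewrite (Tsa (ltW h0)) ipE => hle.
  have -> : (expR (c' * h) * `|y|) ^+ 2 = expR (c' * (h + h)) * `|y| ^+ 2.
    by rewrite exprMn mulrDr expRD -expr2.
  have /(ler_wpM2r (sqr_ge0 `|y|)) := expR_ge1Dx (c' * (h + h)).
  lra.
have := orbit_last_step n.+1 (ltW h0) x0; rewrite n1 -/y ler_pdivrMr// => h1.
apply: (le_trans h1); rewrite ler_pM2r//.
have -> : expR c' = expR (c' * h) ^+ n.+1.
  by rewrite -expRM_natr -mulrA (mulrC h) n1 mulr1.
by rewrite lerXn2r ?nnegrE ?expR_ge0// divr_ge0.
Unshelve. all: by end_near. Qed.

(** The form ((w - A) x | y) is symmetric and nonnegative on the domain by
    [generator_le]. Let z solve (w - A) z = x. Evaluating the form at z - M x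
    gives 0 <= (x | z) - 2 M |x|^2 + M^2 ((w - A) x | x), while (x | z) <= M
    |x|^2. *)
Lemma coercive_of_bounded_inverse M : 0 < M ->
  (forall x, op_dom A x -> `|x| <= M * `|w *: x - op_fun A x|) ->
  (forall y, exists x, op_dom A x /\ w *: x - op_fun A x = y) ->
  forall x, op_dom A x -> ip (op_fun A x) x <= (w - M^-1) * `|x| ^+ 2.
Proof.
move=> M0 lowb onto x xA; have [z [zA zx]] := onto x.
have [dA ed] := generator_linear (- M) xA zA.
have := generator_le ipE T_le dA; rewrite ed.
have zM : ip x z <= M * `|x| ^+ 2.
  apply: le_trans (cauchy_schwarz ipE _ _) _.
  rewrite mulrC expr2 mulrA ler_wpM2r//.
  by have := lowb _ zA; rewrite zx.
have Az : op_fun A z = w *: z - x by rewrite -zx subKr.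
have xz : ip (op_fun A x) z = w * ip z x - `|x| ^+ 2.
  rewrite (ipC (ip := ip)) -(generator_symmetric ipE Tsa zA xA) -/A Az.
  by rewrite ipDl ipNl ipZl ipE.
rewrite -(ipE (_ + _)) !ip_lin xz Az !ip_lin ipE (ipC (ip := ip) z x) => main.
have M2 : 0 < M ^+ 2 by rewrite exprn_gt0.
rewrite -(ler_pM2l M2).
have -> : M ^+ 2 * ((w - M^-1) * `|x| ^+ 2) = w * M ^+ 2 * `|x| ^+ 2 - M * `|x| ^+ 2.
  by field; rewrite gt_eqF.
rewrite -!ipE in main zM *; nra.
Qed.

End NumericalBound.

(** * Complex resolvents *)

Section ComplexNorm.
Context {R : realType} {V : normedModType R}.
Implicit Types z : complexification V.

Lemma cnorm_ge0 z : 0 <= cnorm z.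
Proof. exact: sqrtr_ge0. Qed.

Lemma cnorm_le z : cnorm z <= `|z.1| + `|z.2|.
Proof.
rewrite -ler_sqr ?nnegrE ?addr_ge0 ?cnorm_ge0// sqr_sqrtr ?addr_ge0 ?sqr_ge0//.
rewrite sqrrD lerD2r lerDl mulrn_wge0// mulr_ge0//.
Qed.

Lemma norm_fst_le z : `|z.1| <= cnorm z.
Proof.
rewrite -ler_sqr ?nnegrE ?cnorm_ge0// sqr_sqrtr ?addr_ge0 ?sqr_ge0//.
by rewrite lerDl sqr_ge0.
Qed.

Lemma norm_snd_le z : `|z.2| <= cnorm z.
Proof.
rewrite -ler_sqr ?nnegrE ?cnorm_ge0// sqr_sqrtr ?addr_ge0 ?sqr_ge0//.
by rewrite lerDr sqr_ge0.
Qed.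

Lemma complexification_linE (c d : R) z y : (c +i* d)%C *: z + y =
  (c *: z.1 - d *: z.2 + y.1, d *: z.1 + c *: z.2 + y.2).
Proof. by []. Qed.

Lemma cnorm_real (x : V) : cnorm (x, 0) = `|x|.
Proof. by rewrite /cnorm/= normr0 expr0n/= addr0 sqrtr_sqr normr_id. Qed.

End ComplexNorm.

Section ComplexResolvent.
Context {R : realType} {H : completeNormedModType R} {ip : {dot H for idfun}}.
Hypothesis ipE : inner_product_for ip.
Context {T : R -> {linear H -> H}}.
Hypotheses (TC0 : C0_semigroup T) (Tsa : selfadjoint_semigroup ip T).
Let A := generator T.

(** The operator 1 + b^2 Q^2 is at least 1 because Q is symmetric, so
    [coercive_inverse] applies; its inverse commutes with Q since it does. *)
Lemma perturbed_identity_inverse (Q : {linear H -> H}) (C b : R) :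
  (forall y, `|Q y| <= C * `|y|) -> (forall x y, ip (Q x) y = ip x (Q y)) ->
  exists K : {linear H -> H},
  [/\ forall y, K y + b ^+ 2 *: Q (Q (K y)) = y,
      forall y, K (Q y) = Q (K y) & forall y, `|K y| <= `|y|].
Proof.
move=> QC Qsym.
have lB : linear (fun y => y + b ^+ 2 *: Q (Q y)).
  move=> c x y; apply: (ip_ext ipE) => z; rewrite !linearP/= !ip_lin; ring.
have [B BE] := linear_witness lB.
have C1 : 0 <= `|C| by [].
have QC' y : `|Q y| <= `|C| * `|y|.
  by rewrite (le_trans (QC y))// ler_wpM2r// ler_norm.
have Bb y : `|B y| <= (1 + b ^+ 2 * `|C| ^+ 2) * `|y|.
  rewrite BE (le_trans (ler_normD _ _))// mulrDl mul1r lerD2l.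
  rewrite normrZ ger0_norm ?sqr_ge0// -mulrA ler_wpM2l ?sqr_ge0//.
  by rewrite (le_trans (QC' _))// expr2 -mulrA ler_wpM2l.
have Bc y : 1 * `|y| ^+ 2 <= ip (B y) y.
  rewrite BE !ip_lin ipE mul1r Qsym ipE lerDl mulr_ge0 ?sqr_ge0//.
have [K [BK KB Kb]] := coercive_inverse ipE ltr01 Bb Bc.
exists K; split=> y.
- by rewrite -BE.
- have QB x : Q (B x) = B (Q x) by rewrite !BE linearD linearZ.
  by rewrite -{1}(BK y) QB KB.
- by rewrite -[leLHS]mul1r.
Qed.

Variable w : R.
Hypothesis T_le : forall t x, 0 <= t -> `|T t x| <= expR (w * t) * `|x|.

(** With Q = (a - A)^-1 and K = (1 + b^2 Q^2)^-1, the operator S below is K (Q -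
    i b Q^2) in terms of real and imaginary parts. *)
Lemma half_plane_resolvent (l : R[i]) : w < complex.Re l ->
  resolvent_set (complexify A) l.
Proof.
case: l => a b /= wa.
have [Q [QP PQ Qb Qsym]] := real_resolvent ipE TC0 Tsa T_le wa.
have aw : 0 < a - w by rewrite subr_gt0.
have QC y : `|Q y| <= (a - w)^-1 * `|y| by rewrite mulrC ler_pdivlMr// mulrC.
have [K [BK KQ Kb]] := perturbed_identity_inverse b QC Qsym.
have QZ c x : Q (c *: x) = c *: Q x by exact: linearZ.
have KZ c x : K (c *: x) = c *: K x by exact: linearZ.
pose QK_lin := (linearD Q, linearN Q, linearD K, linearN K, QZ, KZ).
pose S (z : complexification H) : complexification H :=
  (Q (K z.1 + b *: Q (K z.2)), Q (K z.2 - b *: Q (K z.1))).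
have Slin : linear S.
  move=> [c d] z y; rewrite !complexification_linE /S /=.
  congr (_, _); apply: (ip_ext ipE) => x.
    rewrite !QK_lin !ip_lin; ring.
  rewrite !QK_lin !ip_lin; ring.
have [S' SE] := linear_witness Slin.
exists S'; split.
- pose C := (a - w)^-1; have C0 : 0 <= C by rewrite invr_ge0 ltW.
  exists (2 * (C * (1 + `|b| * C))) => z; rewrite SE.
  have Cb (e x y : H) : `|e| = `|b *: Q (K y)| -> `|x| <= cnorm z ->
      `|y| <= cnorm z -> `|Q (K x + e)| <= C * (1 + `|b| * C) * cnorm z.
    move=> eE xz yz; apply: (le_trans (QC _)); rewrite -mulrA ler_wpM2l//.
    apply: (le_trans (ler_normD _ _)); rewrite eE mulrDl mul1r lerD//.
      exact: le_trans (Kb _) xz.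
    rewrite normrZ -mulrA ler_wpM2l//; apply: le_trans (QC _) _.
    by rewrite ler_wpM2l// (le_trans (Kb _)).
  apply: le_trans (cnorm_le _) _; rewrite -mulrA mulr_natl mulr2n lerD//.
    by apply: (Cb _ _ z.2) => //; [exact: norm_fst_le | exact: norm_snd_le].
  by apply: (Cb _ _ z.1) => //; [rewrite normrN | exact: norm_snd_le | exact: norm_fst_le].
- move=> z; rewrite SE; set x1 := K z.1 + b *: Q (K z.2).
  set x2 := K z.2 - b *: Q (K z.1).
  have [d1 e1] := QP x1; have [d2 e2] := QP x2; split => //.
  have -> : (a +i* b)%C *: S z - op_fun (complexify A) (S z) =
    (a *: Q x1 - b *: Q x2 - op_fun A (Q x1),
     b *: Q x1 + a *: Q x2 - op_fun A (Q x2)) by [].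
  rewrite (addrAC _ (- (b *: Q x2))) e1 -(addrA (b *: Q x1)) e2 [RHS]surjective_pairing.
  rewrite -(BK z.1) -(BK z.2).
  congr (_, _); apply: (ip_ext ipE) => x; rewrite /x1 /x2 !QK_lin !ip_lin; ring.
- move=> z [d1 d2]; rewrite SE.
  have := PQ _ d2; have := PQ _ d1.
  set p1 := a *: z.1 - _; set p2 := a *: z.2 - _ => Qp1 Qp2.
  have -> : (a +i* b)%C *: z - op_fun (complexify A) z =
      (p1 - b *: z.2, p2 + b *: z.1).
    have -> : (a +i* b)%C *: z - op_fun (complexify A) z =
      (a *: z.1 - b *: z.2 - op_fun A z.1,
       b *: z.1 + a *: z.2 - op_fun A z.2) by [].
    by rewrite addrAC -(addrA (b *: z.1)) (addrC (b *: z.1)).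
  clearbody p1 p2.
  rewrite /S/= [RHS]surjective_pairing -[in RHS](BK z.1) -[in RHS](BK z.2).
  congr (_, _); apply: (ip_ext ipE) => x;
    rewrite !QK_lin -?(KQ p1) -?(KQ p2) Qp1 Qp2 !ip_lin; ring.
Qed.

End ComplexResolvent.

(** * The spectral bound *)

Section SpectralBound.
Context {R : realType} {H : completeNormedModType R} {ip : {dot H for idfun}}.
Hypothesis ipE : inner_product_for ip.
Context {T : R -> {linear H -> H}}.
Hypotheses (TC0 : C0_semigroup T) (Tsa : selfadjoint_semigroup ip T).
Variable w : R.
Hypothesis T_le : forall t x, 0 <= t -> `|T t x| <= expR (w * t) * `|x|.
Hypothesis T1_least : forall c, (forall x, `|T 1 x| <= c * `|x|) -> expR w <= c.
Let A := generator T.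

(** On real vectors, an inverse of w - A on the complexification gives a lower
    bound and surjectivity for w - A. Then T would decay faster than e^w. *)
Lemma growth_rate_in_spectrum : spectrum A (w +i* 0)%C.
Proof.
move=> [S [[M0 SM] right_inv left_inv]].
have realE (z : complexification H) :
    (w +i* 0)%C *: z - op_fun (complexify A) z =
    (w *: z.1 - op_fun A z.1, w *: z.2 - op_fun A z.2).
  have -> : (w +i* 0)%C *: z - op_fun (complexify A) z =
    (w *: z.1 - 0 *: z.2 - op_fun A z.1, 0 *: z.1 + w *: z.2 - op_fun A z.2) by [].
  by rewrite !scale0r subr0 add0r.
have [A0 A0E] : op_dom A 0 /\ op_fun A 0 = 0 by exact: generator0.
(* The bound of the inverse is only known to be some real number. *)
pose M := Num.max M0 1.
have M1 : 1 <= M by rewrite le_max lexx orbT.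
have Mgt0 : 0 < M by apply: lt_le_trans M1.
have lowb x : op_dom A x -> `|x| <= M * `|w *: x - op_fun A x|.
  move=> xA; have := left_inv (x, 0) (conj xA A0).
  rewrite realE [(x, 0).2]/= A0E scaler0 subr0 => Sx.
  have := SM (w *: x - op_fun A x, 0); rewrite Sx !cnorm_real => /le_trans; apply.
  by rewrite ler_wpM2r// le_max lexx.
have onto y : exists x, op_dom A x /\ w *: x - op_fun A x = y.
  have [[d _]] := right_inv (y, 0); rewrite realE => -[e _].
  by exists (S (y, 0)).1.
have Mi : 0 < M^-1 by rewrite invr_gt0.
have num := coercive_of_bounded_inverse ipE Tsa T_le Mgt0 lowb onto.
have lt_c : w - M^-1 < w - M^-1 / 2 by rewrite ltrD2l ltrN2 ltr_pdivrMr// ltr_pMr// ltr1n.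
have := T1_least (decay_of_numerical_bound ipE TC0 Tsa T_le lt_c num).
by rewrite ler_expR leNgt ltrBlDr ltrDl divr_gt0.
Qed.

Lemma spectral_boundE : spectral_bound A = w%:E.
Proof.
apply/eqP; rewrite eq_le; apply/andP; split.
  apply: ge_ereal_sup => _ [l lA <-]; rewrite lee_fin leNgt.
  by apply/negP => wl; apply: lA; exact: (half_plane_resolvent ipE TC0 Tsa T_le).
by apply: ereal_sup_ubound; exists (w +i* 0)%C => //; exact: growth_rate_in_spectrum.
Qed.

End SpectralBound.

(** * Orbits in an ordered Hilbert space *)

Section PositiveOrbits.
Context {R : realType} {H : completeNormedModType R} {ip : {dot H for idfun}}.
Hypothesis ipE : inner_product_for ip.
Context {T : R -> {linear H -> H}}.
Hypotheses (TC0 : C0_semigroup T) (Tsa : selfadjoint_semigroup ip T).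
Context {C : set H}.
Hypothesis Tpos : positive_semigroup C T.
Hypothesis C_dual : C `<=` dual_cone ip C.

(** Both differences (v | T t (u - q)) and (v - q | T t q) are pairings of
    elements of the cone. *)
Lemma matrix_entry_ge (q u v : H) t : 0 <= t -> C q -> cone_le C q u ->
  cone_le C q v -> C v -> ip q (T t q) <= ip v (T t u).
Proof.
move=> t0 Cq qu qv Cv.
have h1 : 0 <= ip v (T t (u - q)) by apply: C_dual => //; exact: Tpos.
have h2 : 0 <= ip (v - q) (T t q) by apply: C_dual => //; exact: Tpos.
move: h1 h2; rewrite linearB !ip_lin; lra.
Qed.

(** The vectors a q - x and T t (a q + x) lie in the cone; the mixed terms of
    their pairing cancel by symmetry. *)
Lemma order_interval_entry_le (q x : H) (a : R) t : 0 <= t ->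
  cone_le C (- (a *: q)) x -> cone_le C x (a *: q) ->
  ip x (T t x) <= a ^+ 2 * ip q (T t q).
Proof.
rewrite /cone_le opprK => t0 lo hi.
have : 0 <= ip (a *: q - x) (T t (x + a *: q)).
  by apply: C_dual => //; exact: Tpos.
rewrite linearD linearZ/= !ip_lin -(Tsa t0 q x) (ipC (ip := ip) (T t q) x); lra.
Qed.

Variable w : R.
Hypothesis T_le : forall t x, 0 <= t -> `|T t x| <= expR (w * t) * `|x|.
Hypothesis T1_least : forall c, (forall x, `|T 1 x| <= c * `|x|) -> expR w <= c.

(** Since the order intervals [- n q, n q] fill a dense set, one of their points
    x witnesses |T 1 x| > e^b |x|. Log-convexity gives |T k x| >= e^(b k) |x| at
    integers k, and [order_interval_entry_le] transfers this to q. A time s = t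
    / 2 is compared with the next integer k at the cost of the factor e^(- |b| -
    |w|). *)
Lemma quasi_interior_entry_ge q b : quasi_interior C q -> b < w ->
  exists2 c, 0 < c & forall t, 0 <= t -> c * expR (b * t) <= ip q (T t q).
Proof.
move=> [Cq q_dense] bw.
have [x [n _ [lo hi]] big_x] : exists2 x,
    (\bigcup_n order_interval C (- (q *+ n)) (q *+ n)) x & expR b * `|x| < `|T 1 x|.
  apply: contrapT => none; have := bw; rewrite ltNge -ler_expR => /negP; apply.
  apply: T1_least; apply: (@dense_norm_bound _ _ _
    (\bigcup_n order_interval C (- (q *+ n)) (q *+ n))).
  - exact: (@C0_bounded _ _ _ TC0).
  - exact: expR_ge0.
  - move=> x e e0; have [||y [xy qy]] := q_dense (ball x e).
    - by exists x; exact: ballxx.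
    - exact: ball_open.
    by exists y => //; move: xy; rewrite -ball_normE.
  - move=> y qy; rewrite leNgt; apply/negP => hy; apply: none; by exists y.
have x0 : x != 0.
  by apply/eqP => x0; move: big_x; rewrite x0 linear0 normr0 mulr0 ltxx.
have nx : 0 < `|x| by rewrite normr_gt0.
(* Dividing by n + 1 instead of n spares a separate treatment of n = 0. *)
pose c := `|x| * expR (- (`|b| + `|w|)) / n.+1%:R.
have c0 : 0 < c by rewrite divr_gt0// mulr_gt0// expR_gt0.
exists (c ^+ 2) => [|t t0]; first by rewrite exprn_gt0.
pose s := t / 2; have s0 : 0 <= s by rewrite divr_ge0.
have entry y (r : R) : 0 <= r -> ip y (T (r + r) y) = `|T r y| ^+ 2.
  by move=> r0; rewrite (C0_add TC0)// -(Tsa r0) ipE.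
have ss : t = s + s by rewrite /s; field.
rewrite ss entry// mulrDr expRD -expr2 -exprMn ler_sqr ?nnegrE ?mulr_ge0 ?expR_ge0
  ?(ltW c0)//.
pose k := (Num.truncn s).+1.
have /andP[k1 k2] : s < k%:R <= s + 1.
  by rewrite truncnS_gt -natr1 lerD2r truncn_le.
have k0 : 0 <= k%:R :> R by [].
have grow : `|x| * expR (b * k%:R) <= `|T k%:R x|.
  have := orbit_first_step ipE TC0 Tsa k ler01 x0; rewrite mulr1 ler_pdivlMr// mulrC.
  apply: le_trans; rewrite ler_wpM2l// expRM_natr lerXn2r ?nnegrE ?expR_ge0 ?divr_ge0//.
  by rewrite ler_pdivlMr// ltW.
have dom : `|T k%:R x| <= n.+1%:R * `|T k%:R q|.
  rewrite -ler_sqr ?nnegrE ?mulr_ge0// exprMn -!entry//.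
  have := order_interval_entry_le (q := q) (x := x) (a := n%:R) (addr_ge0 k0 k0).
  rewrite !scaler_nat => /(_ lo hi) /le_trans; apply.
  by rewrite ler_wpM2r ?entry ?sqr_ge0// ler_sqr ?nnegrE// ler_nat.
have back : `|T k%:R q| <= expR `|w| * `|T s q|.
  have -> : T k%:R q = T (k%:R - s) (T s q).
    by rewrite -(C0_add TC0) ?subrK// subr_ge0 ltW.
  apply: le_trans (T_le _ _) _; first by rewrite subr_ge0 ltW.
  rewrite ler_wpM2r// ler_expR; apply: le_trans (ler_norm _) _.
  by rewrite normrM ler_piMr// ger0_norm ?subr_ge0 ?(ltW k1)// lerBlDr addrC.
have shift : expR (b * s) * expR (- `|b|) <= expR (b * k%:R).
  rewrite -expRD ler_expR lerBlDl -lerBlDr -mulrBr.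
  rewrite -normrN (le_trans (ler_norm _))// normrM ?normrN.
  rewrite ler_piMr// ler0_norm ?subr_le0 ?(ltW k1)// opprB lerBlDr addrC//.
have big : `|x| * (expR (b * s) * expR (- `|b|)) <= n.+1%:R * (expR `|w| * `|T s q|).
  apply: le_trans (ler_wpM2l (ltW nx) shift) _; apply: (le_trans grow).
  by apply: (le_trans dom); rewrite ler_wpM2l.
rewrite /c opprD expRD mulrAC ler_pdivrMr ?ltr0n//.
rewrite -(ler_pM2r (expR_gt0 `|w|)).
have ww : expR (- `|w|) * expR `|w| = 1 by rewrite -expRD addNr expR0.
have -> : `|x| * (expR (- `|b|) * expR (- `|w|)) * expR (b * s) * expR `|w| =
  `|x| * (expR (b * s) * expR (- `|b|)) * (expR (- `|w|) * expR `|w|) by ring.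
rewrite ww mulr1; apply: (le_trans big).
by rewrite le_eqVlt; apply/orP; left; apply/eqP; ring.
Qed.

End PositiveOrbits.

(** * The logarithmic limit *)

(** The constants K and c contribute ln K / t and ln c / t, which vanish in the
    limit. *)
Lemma log_growth_cvg (R : realType) (f : R -> R) (w K : R) :
  (forall t, 0 <= t -> f t <= K * expR (w * t)) ->
  (forall b, b < w -> exists2 c, 0 < c & forall t, 0 <= t -> c * expR (b * t) <= f t) ->
  (lne (f t)%:E * (t^-1)%:E)%E @[t --> +oo] --> w%:E.
Proof.
move=> f_le f_ge.
have f_gt0 t : 0 <= t -> 0 < f t.
  move=> t0; have [|c c0 cf] := f_ge (w - 1); first by rewrite ltrBlDr ltrDl.
  by apply: lt_le_trans (cf t t0); rewrite mulr_gt0 ?expR_gt0.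
have K0 : 0 < K.
  by have := lt_le_trans (f_gt0 0 (lexx _)) (f_le 0 (lexx _)); rewrite mulr0 expR0 mulr1.
have main : ln (f t) / t @[t --> +oo] --> w.
  apply/cvgrPdist_le => e e0.
  have [|c c0 cf] := f_ge (w - e / 2); first by rewrite ltrBlDr ltrDl divr_gt0.
  near=> t.
  have t0 : 0 < t by near: t; apply: nbhs_pinfty_gt; rewrite num_real.
  have f0 := f_gt0 t (ltW t0).
  have lower : ln c + (w - e / 2) * t <= ln (f t).
    rewrite -[X in _ + X <= _]expRK -lnM ?posrE ?expR_gt0//.
    by rewrite ler_ln ?posrE ?mulr_gt0 ?expR_gt0// cf// ltW.
  have upper : ln (f t) <= ln K + w * t.
    rewrite -[X in _ <= _ + X]expRK -lnM ?posrE ?expR_gt0//.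
    by rewrite ler_ln ?posrE ?mulr_gt0 ?expR_gt0// f_le// ltW.
  have ct : `|ln c| <= e / 2 * t.
    rewrite mulrC -ler_pdivrMr; last by rewrite divr_gt0.
    near: t.
    by apply: nbhs_pinfty_ge; rewrite num_real.
  have Kt : `|ln K| <= e * t.
    rewrite mulrC -ler_pdivrMr; last exact: e0.
    near: t.
    by apply: nbhs_pinfty_ge; rewrite num_real.
  have := ler_norm (ln K); have := ler_norm (- ln c); rewrite normrN => hc hK.
  rewrite ler_norml; apply/andP; split.
    by rewrite lerBrDr addrC lerBlDl ler_pdivrMr//; lra.
  by rewrite lerBlDr -lerBlDl ler_pdivlMr//; lra.
have : (ln (f t) / t)%:E @[t --> +oo] --> w%:E by apply: cvg_EFin => //; exact: nearW.
apply: cvg_trans; apply: near_eq_cvg; near=> t.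
have t0 : 0 <= t by near: t; apply: nbhs_pinfty_ge; rewrite num_real.
by rewrite lne_EFin ?EFinM// f_gt0.
Unshelve. all: by end_near. Qed.

Theorem theorem7p5 (R : realType) (H : completeNormedModType R)
    (ip : {dot H for idfun}) (C : set H) (T : R -> {linear H -> H})
    (u v : H) :
  inner_product_for ip ->
  (exists x : H, x != 0) ->
  closed_cone C ->
  C0_semigroup T ->
  positive_semigroup C T ->
  selfadjoint_semigroup ip T ->
  C `<=` dual_cone ip C ->
  C u -> C v ->
  (exists w : H, [/\ quasi_interior C w, cone_le C w u & cone_le C w v]) ->
  [/\ (-oo < spectral_bound (generator T))%E,
      spectral_bound (generator T) = growth_bound T &
      (lne (ip v (T t u))%:E * (t^-1)%:E)%E @[t --> +oo]
        --> growth_bound T].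
Proof.
move=> ipE H_neq0 coneC TC0 Tpos Tsa C_dual Cu Cv [q [q_int qu qv]].
have [w [T1_le T1_least]] := exists_growth_rate ipE TC0 Tsa H_neq0.
have T_le := norm_semigroup_le ipE TC0 Tsa T1_le.
rewrite (growth_boundE ipE TC0 Tsa T1_le T1_least).
rewrite (spectral_boundE ipE TC0 Tsa T_le T1_least); split => //.
  exact: ltNyr.
apply: (@log_growth_cvg _ _ _ (`|v| * `|u|)) => [t t0|b bw].
  apply: le_trans (cauchy_schwarz ipE _ _) _.
  by rewrite -mulrA ler_wpM2l// mulrC T_le.
have [c c0 cq] := quasi_interior_entry_ge ipE TC0 Tsa Tpos C_dual T_le T1_least q_int bw.
exists c => // t t0; apply: le_trans (cq t t0) _.
by case: q_int => Cq _; apply: (matrix_entry_ge Tpos C_dual).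
Qed.
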